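(* Let $G_S$ be a self-loop graph with loop vector $s$ and loop resolvent $R_{G,S}(p)=s^\top(pI+\mathcal{L}(G_S))^{-1}s$ ($p>0$). Let $\mathcal{L}(G_S)=\sum_\lambda\lambda P_\lambda$, the sum being over the distinct eigenvalues and $P_\lambda$ denoting the orthogonal projection onto the $\lambda$-eigenspace. Then the following hold. (i) $R_{G,S}$ has the spectral representation $$R_{G,S}(p)=\sum_\lambda\frac{\|P_\lambda s\|^2}{p+\lambda}.$$ Consequently, the right-hand side gives a rational continuation of $R_{G,S}$ to $\mathbb{C}$, with poles precisely at those points $p=-\lambda$ for which $P_\lambda s\ne0$. (ii) $R_{G,S}$ (through this continuation) has the Laurent expansion at $p=\infty$ $$R_{G,S}(p)=\sum_{k=0}^\infty\frac{(-1)^k m_k(G,S)}{p^{k+1}},$$ valid for all sufficiently large $|p|$, where $m_k(G,S):=s^\top\mathcal{L}(G_S)^ks$ is the $k$-th loop moment.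
   Context: Let $G$ be a finite undirected simple graph with vertex set $V=\{1,\dots,N\}$ (possibly disconnected), and $S\subseteq V$. The self-loop graph $G_S$ is obtained from $G$ by attaching one loop at every vertex of $S$. The loop vector $s\in\mathbb{R}^N$ is the indicator vector of $S$. $\mathcal{L}(G)=D(G)-A(G)$ is the ordinary Laplacian and $\mathcal{L}(G_S):=\mathcal{L}(G)+\mathrm{diag}(s)$, a positive semidefinite matrix. *)

(* Defs.v *)
From HB Require Import structures.
From mathcomp Require Import all_boot all_order all_algebra sesquilinear.
From mathcomp Require Import complex.
From mathcomp Require Import all_classical all_reals all_analysis.

Set Implicit Arguments.
Unset Strict Implicit.
Unset Printing Implicit Defensive.

Import Order.TTheory GRing.Theory Num.Theory.
Import numFieldNormedType.Exports.

Local Open Scope classical_set_scope.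
Local Open Scope ring_scope.
Local Open Scope complex_scope.

Section SelfLoopGraph.
Variables (R : realType) (N : nat).

(* A simple graph on 'I_N is given by its adjacency relation [e]; symmetry and
   irreflexivity of [e] are hypotheses of the theorem. *)
Definition adjmx (e : rel 'I_N) : 'M[R]_N := \matrix_(i, j) (e i j)%:R.

Definition degmx (e : rel 'I_N) : 'M[R]_N :=
  diag_mx (\row_i #|[set j | e i j]%SET|%:R).

Definition laplacian (e : rel 'I_N) : 'M[R]_N := degmx e - adjmx e.

Definition loop_vec (S : {set 'I_N}) : 'cV[R]_N := \col_i (i \in S)%:R.

Definition loop_laplacian (e : rel 'I_N) (S : {set 'I_N}) : 'M[R]_N :=
  laplacian e + diag_mx (loop_vec S)^T.

(* Meant for [0 < p]: the matrix is then positive definite, so [invmx] is a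
   genuine inverse. *)
Definition loop_resolvent (e : rel 'I_N) (S : {set 'I_N}) (p : R) : R :=
  ((loop_vec S)^T *m invmx (p%:M + loop_laplacian e S) *m loop_vec S) 0 0.

Definition loop_moment (e : rel 'I_N) (S : {set 'I_N}) (k : nat) : R :=
  ((loop_vec S)^T *m loop_laplacian e S ^+ k *m loop_vec S) 0 0.

Definition eigenvalues (A : 'M[R]_N) : set R := [set l | eigenvalue A l].

(* Matrix, acting on column vectors, of the orthogonal projection onto the
   [l]-eigenspace of [A], for the standard inner product.  In the library
   subspaces are row spaces and [proj_mx] acts on row vectors from the right,
   hence the transpositions; [orthomx idfun 1%:M U] is the orthogonal
   complement of the row space of [U]. *)
Definition eigenproj (A : 'M[R]_N) (l : R) : 'M[R]_N :=
  let U := eigenspace A^T l in (proj_mx U (orthomx idfun 1%:M U))^T.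

(* The square of the Euclidean norm; the library norm on matrices is the sup
   norm. *)
Definition sqnorm (v : 'cV[R]_N) : R := \sum_i v i 0 ^+ 2.

Definition loop_weight (e : rel 'I_N) (S : {set 'I_N}) (l : R) : R :=
  sqnorm (eigenproj (loop_laplacian e S) l *m loop_vec S).

(* The right-hand side of the spectral representation at a complex point; since
   [x / 0 = 0], its value at a pole is not meaningful. *)
Definition loop_continuation (e : rel 'I_N) (S : {set 'I_N}) (z : R[i]) : R[i] :=
  \sum_(l \in eigenvalues (loop_laplacian e S))
    (loop_weight e S l)%:C / (z + l%:C).

End SelfLoopGraph.

Section RationalFunctions.
Variable R : realType.

(* [f] is given by a fraction in lowest terms wherever the denominator does not
   vanish. *)
Definition rational_function (f : R[i] -> R[i]) : Prop :=
  exists n d : {poly R[i]},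
    [/\ d != 0, coprimep n d & forall z, ~~ root d z -> f z = n.[z] / d.[z]].

(* For a function with isolated singularities, such as a rational one, poles are
   the points at which the modulus tends to infinity.  [R[i]^o] is the complex
   numbers with the topology of the modulus. *)
Definition pole (f : R[i] -> R[i]) (z : R[i]) : Prop :=
  complex.Re `|f w| @[w --> (z : R[i]^o)^'] --> +oo.

End RationalFunctions.

(* Main.v *)
Require Import Defs.
From mathcomp Require Import all_boot all_order all_algebra spectral sesquilinear.
From mathcomp Require Import ring.
From mathcomp Require Import complex.
From mathcomp Require Import all_classical all_reals all_analysis.

Import Order.TTheory GRing.Theory Num.Theory.
Import numFieldNormedType.Exports.

Local Open Scope classical_set_scope.
Local Open Scope ring_scope.
Local Open Scope complex_scope.

(** Why the theorem holds.

    The loop Laplacian L is a real symmetric matrix, so its eigenspaces are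
    mutually orthogonal and span the space ([symmx_diagonalizable],
    [eigen_orthogonal]).  Hence the orthogonal projections P_l onto them satisfy
    L P_l = l P_l and sum to the identity ([spectral_resolution]), and
    f(L) = \sum_l f(l) P_l when f is the identity, a power or x |-> 1/(p + x).
    Since P_l is symmetric and idempotent, s^T P_l s = |P_l s|^2, so
    s^T f(L) s = \sum_l f(l) |P_l s|^2 ([spectral_form]).  The case of
    1/(p + x) is the spectral representation; it requires p + l <> 0, which for
    p > 0 follows from L being positive semidefinite
    ([loop_laplacian_eigenvalue_ge0]).  The case of a power gives the moments:
    m_k = \sum_l l^k |P_l s|^2.

    What remains concerns only functions of the form
    F(z) = \sum_a c_a / (z - a), here with a = - l and c_a = |P_l s|^2.  Reducing
    to a common denominator after discarding the terms with c_a = 0 gives a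
    fraction in lowest terms ([partial_fractions_lowest_terms]).  Near a point a
    with c_a <> 0 a single term tends to infinity and the others stay bounded;
    at all other points F is continuous ([partial_fractions_poleP]).  Finally
    1/(z - a) = \sum_k a^k / z^(k+1) as soon as |z| > |a|, and summing these
    finitely many geometric series gives the Laurent expansion
    ([partial_fractions_laurent]). *)

Set Implicit Arguments.
Unset Strict Implicit.
Unset Printing Implicit Defensive.

(** * Diagonalization of real symmetric matrices *)

Lemma map_symmx_real_hermsym (R : rcfType) n (A : 'M[R]_n) :
  A^T = A -> map_mx (real_complex R) A \is hermsymmx.
Proof.
move=> A_sym; apply: realsym_hermsym.
  by rewrite qualifE /= expr0 scale1r map_mx_id // map_trmx A_sym.
by apply/mxOverP => i j; rewrite mxE complex_real.
Qed.

Lemma real_rV_lift (R : rcfType) n (D : 'rV[R[i]]_n) :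
  D \is a mxOver Num.real -> exists d, D = map_mx (real_complex R) d.
Proof.
move=> /mxOverP D_real; exists (map_mx (@complex.Re R) D).
by apply/rowP => j; rewrite !mxE RRe_real.
Qed.

Lemma mxminpoly_similar (F : fieldType) n (P B : 'M[F]_n.+1) :
  P \in unitmx -> mxminpoly (invmx P *m B *m P) = mxminpoly B.
Proof.
move=> P_unit.
have PV_unit : invmx P \in unitmx by rewrite unitmx_inv.
have := mxminpoly_uconj B PV_unit; rewrite conjVmx //; exact.
Qed.

Lemma normalmx_mxminpoly (C : numClosedFieldType) n (B : 'M[C]_n.+1) :
  B \is normalmx -> mxminpoly B = mxminpoly (diag_mx (spectral_diag B)).
Proof.
move=> /orthomx_spectralP B_eq.
rewrite -[RHS](@mxminpoly_similar _ _ (spectralmx B)); last first.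
  exact: spectral_unit.
exact: (congr1 (@mxminpoly _ _) B_eq).
Qed.

(** Over R[i] the matrix is Hermitian, hence unitarily similar to a diagonal
    matrix whose entries are real.  The minimal polynomial does not change under
    field extension, so already over R it is a product of distinct linear
    factors, which characterizes diagonalizability. *)
Lemma symmx_diagonalizable (R : rcfType) n (A : 'M[R]_n) :
  A^T = A -> diagonalizable A.
Proof.
case: n A => [|n] A A_sym; first by rewrite (flatmx0 A); exact: diagonalizable0.
have B_herm := @map_symmx_real_hermsym _ _ _ A_sym.
have D_real := hermitian_spectral_diag_real B_herm.
have minB := @normalmx_mxminpoly _ _ _ (hermitian_normalmx B_herm).
have [d dE] := @real_rV_lift _ _ _ D_real.
apply/diagonalizableP.
exists (undup [seq d 0 i | i <- enum 'I_n.+1]); first exact: undup_uniq.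
suff -> : mxminpoly A = mxminpoly (diag_mx d) by rewrite mxminpoly_diag.
have diagE : diag_mx (spectral_diag (map_mx (real_complex R) A)) =
             map_mx (real_complex R) (diag_mx d).
  by rewrite map_diag_mx dE.
have minA := mxminpoly_map (real_complex R) A.
have minD := mxminpoly_map (real_complex R) (diag_mx d).
have : map_poly (real_complex R) (mxminpoly A) =
       map_poly (real_complex R) (mxminpoly (diag_mx d)).
  exact: (etrans (esym minA)
            (etrans minB (etrans (congr1 (@mxminpoly _ _) diagE) minD))).
exact: map_poly_inj.
Qed.

(** * Orthogonal projections for the standard inner product *)

Lemma row_sqr_eq0 (R : realFieldType) n (v : 'rV[R]_n) :
  v *m v^T = 0 -> v = 0.
Proof.
move=> /matrixP/(_ 0 0); rewrite !mxE.
under eq_bigr do rewrite mxE -expr2.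
move=> /psumr_eq0P v0; apply/rowP => i; rewrite mxE.
by apply/eqP; rewrite -sqrf_eq0 v0// => j _; exact: sqr_ge0.
Qed.

(** The hypothesis says that the image of 1 - Q is orthogonal to the image of Q;
    it amounts to Q^T = Q Q^T, and the right-hand side is symmetric. *)
Lemma symmx_of_compl_orthogonal (R : comPzRingType) n (Q : 'M[R]_n) :
  (1%:M - Q) *m Q^T = 0 -> Q^T = Q.
Proof.
rewrite mulmxBl mul1mx => /eqP; rewrite subr_eq0 => /eqP QQt.
by have := congr1 trmx QQt; rewrite trmx_mul !trmxK -QQt => {1}<-.
Qed.

Section OrthogonalProjection.
Variables (R : realFieldType) (n : nat) (U : 'M[R]_n).
Let U' := orthomx idfun 1%:M U.

Lemma sub_orthomxP m (W : 'M[R]_(m, n)) :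
  reflect (W *m U^T = 0) (W <= U')%MS.
Proof. by rewrite /U' /orthomx map_mx_id // mul1mx; exact: sub_kermxP. Qed.

(** A vector in the intersection is orthogonal to itself; this is where the
    order on the scalars matters. *)
Lemma cap_orthomx : (U :&: U' = 0)%MS.
Proof.
apply/eqP; rewrite -submx0; apply/row_subP => i.
set v := row i _; have : (v <= U :&: U')%MS by exact: row_sub.
rewrite sub_capmx => /andP[/submxP[X vX] /sub_orthomxP vU].
by rewrite (@row_sqr_eq0 _ _ v) ?sub0mx // {2}vX trmx_mul mulmxA vU mul0mx.
Qed.

(** Dimension count: the complement is the kernel of a matrix of rank \rank U,
    and it meets U trivially. *)
Lemma add_orthomx : (U + U' :=: 1%:M)%MS.
Proof.
apply/eqmxP; rewrite submx1 sub1mx /row_full eqn_leq rank_leq_col.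
rewrite mxrank_disjoint_sum ?cap_orthomx //.
rewrite /U' /orthomx map_mx_id // mul1mx mxrank_ker mxrank_tr.
by rewrite -maxnE leq_maxr.
Qed.

Let Q := proj_mx U U'.

Lemma tr_proj_orthomx : Q^T = Q.
Proof.
apply: symmx_of_compl_orthogonal.
have /submxP[X QX] : (Q <= U)%MS by rewrite -[Q]mul1mx proj_mx_sub.
have : (1%:M - 1%:M *m Q <= U')%MS by rewrite proj_mx_compl_sub ?add_orthomx.
move=> /sub_orthomxP; rewrite [1%:M *m Q]mul1mx => QU.
by rewrite {2}QX trmx_mul mulmxA QU mul0mx.
Qed.

End OrthogonalProjection.

Section SquaredNorm.
Variables (R : realType) (n : nat).
Implicit Types (v : 'cV[R]_n) (P : 'M[R]_n).

Lemma sqnormE v : sqnorm v = (v^T *m v) 0 0.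
Proof. by rewrite mxE; apply: eq_bigr => i _; rewrite mxE expr2. Qed.

(** Turns each |P_l s|^2 into a quadratic form, where sums over l can be
    recombined into matrices. *)
Lemma sqnorm_proj P v :
  P^T = P -> P *m P = P -> sqnorm (P *m v) = (v^T *m P *m v) 0 0.
Proof.
move=> P_sym P_idem; rewrite sqnormE trmx_mul P_sym mulmxA.
by rewrite -(mulmxA v^T P P) P_idem.
Qed.

Lemma sqnorm_eq0 v : (sqnorm v == 0) = (v == 0).
Proof.
apply/eqP/eqP => [/psumr_eq0P v0|->]; last first.
  by rewrite /sqnorm big1 // => i _; rewrite mxE expr0n.
apply/colP => i; rewrite mxE; apply/eqP; rewrite -sqrf_eq0 v0 // => j _.
exact: sqr_ge0.
Qed.

End SquaredNorm.

(** * Spectral resolution of a symmetric matrix *)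

Section SpectralResolution.
Variables (R : realType) (n : nat) (A : 'M[R]_n).
Hypothesis A_sym : A^T = A.

Lemma eigenproj_sym l : (eigenproj A l)^T = eigenproj A l.
Proof. by rewrite /eigenproj trmxK tr_proj_orthomx. Qed.

(** The two transpositions in the definition of [eigenproj] cancel: the matrix
    is symmetric and so is its argument.  This makes row-space lemmas on
    [proj_mx] directly applicable. *)
Lemma eigenprojE l :
  eigenproj A l =
  proj_mx (eigenspace A l) (orthomx idfun 1%:M (eigenspace A l)).
Proof. by rewrite -eigenproj_sym /eigenproj A_sym trmxK. Qed.

Lemma eigenproj_idem l : eigenproj A l *m eigenproj A l = eigenproj A l.
Proof. by rewrite eigenprojE proj_mx_proj ?cap_orthomx. Qed.

Lemma eigenproj_sub l : (eigenproj A l <= eigenspace A l)%MS.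
Proof. by rewrite eigenprojE -[proj_mx _ _]mul1mx proj_mx_sub. Qed.

Lemma eigenproj_mulr l : eigenproj A l *m A = l *: eigenproj A l.
Proof. exact/eigenspaceP/eigenproj_sub. Qed.

Lemma mul_eigenproj l : A *m eigenproj A l = l *: eigenproj A l.
Proof.
by rewrite -{1}A_sym -eigenproj_sym -trmx_mul eigenproj_mulr linearZ.
Qed.

(** Moving A across the inner product gives l <u, v> = l' <u, v>. *)
Lemma eigen_orthogonal p q (U : 'M[R]_(p, n)) (V : 'M[R]_(q, n)) l l' :
  l != l' -> U *m A = l *: U -> V *m A = l' *: V -> U *m V^T = 0.
Proof.
move=> ll' UA VA.
have : U *m A *m V^T = U *m (V *m A)^T by rewrite trmx_mul A_sym mulmxA.
rewrite UA VA linearZ /= -scalemxAr -scalemxAl => /eqP.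
by rewrite -subr_eq0 -scalerBl scaler_eq0 subr_eq0 (negPf ll') => /eqP.
Qed.

Lemma eigenspace_proj l : eigenspace A l *m eigenproj A l = eigenspace A l.
Proof. by rewrite eigenprojE proj_mx_id ?cap_orthomx. Qed.

Lemma eigenspace_proj0 l l' :
  l != l' -> eigenspace A l *m eigenproj A l' = 0.
Proof.
move=> ll'; rewrite eigenprojE proj_mx_0 ?cap_orthomx //.
by apply/sub_orthomxP/(eigen_orthogonal ll'); exact/eigenspaceP.
Qed.

(** By orthogonality the sum of the projections fixes each eigenspace, hence
    everything as soon as the eigenspaces span. *)
Lemma sum_eigenproj_of_span rs :
  uniq rs -> (\sum_(l <- rs) eigenspace A l :=: 1%:M)%MS ->
  \sum_(l <- rs) eigenproj A l = 1%:M.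
Proof.
move=> rs_uniq span; set T := \sum_(l <- rs) _.
suff : (1%:M <= kermx (1%:M - T))%MS.
  by move=> /sub_kermxP; rewrite mul1mx => /eqP; rewrite subr_eq0 => /eqP.
have sub l : l \in rs -> (eigenspace A l <= kermx (1%:M - T))%MS.
  move=> l_rs; apply/sub_kermxP; rewrite mulmxBr mulmx1 mulmx_sumr.
  rewrite (bigD1_seq l) //= eigenspace_proj big1 ?addr0 ?subrr // => l' l'l.
  by rewrite eigenspace_proj0 // eq_sym.
rewrite -span big_seq; elim/big_rec: _ => [|l V l_rs IH]; first exact: sub0mx.
by rewrite addsmx_sub sub.
Qed.

Lemma eigenproj_eq0 l : ~~ eigenvalue A l -> eigenproj A l = 0.
Proof.
by move=> /negPn/eqP l0; apply/eqP; rewrite -submx0 -l0 eigenproj_sub.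
Qed.

(** Diagonalizability provides a list of scalars whose eigenspaces span, but some
    of these may be trivial; filtering them out leaves exactly the eigenvalues.
    None is missing: an eigenvector for an absent eigenvalue would be orthogonal
    to a spanning family. *)
Lemma spectral_resolution : exists rs : seq R,
  [/\ uniq rs, eigenvalues A = [set` rs]
    & \sum_(l <- rs) eigenproj A l = 1%:M].
Proof.
have /diagonalizablePeigen[rs rs_uniq /(sum_eigenproj_of_span rs_uniq) sum1] :=
  @symmx_diagonalizable _ _ _ A_sym.
exists [seq l <- rs | eigenvalue A l]; split; first exact: filter_uniq.
  apply/seteqP; split=> l /=; rewrite mem_filter; last by case/andP.
  move=> l_ev; rewrite l_ev /=; apply: contraT => l_rs.
  case/negP: l_ev; apply/eqP; rewrite -[LHS]mulmx1 -sum1 mulmx_sumr.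
  rewrite big_seq big1 // => l' l'_rs.
  by rewrite eigenspace_proj0 //; apply: contraNneq l_rs => ->.
rewrite big_filter -sum1 [RHS](bigID (eigenvalue A)) /=.
by rewrite [X in _ + X]big1 ?addr0 // => l; exact: eigenproj_eq0.
Qed.

(** Only the resolution of the identity over [rs] is used below, so that the
    formulas can be read as f(A) = \sum_l f(l) P_l for three choices of f. *)
Section FunctionalCalculus.
Variable rs : seq R.
Hypothesis sum_eigenproj : \sum_(l <- rs) eigenproj A l = 1%:M.

Lemma spectral_decomposition : A = \sum_(l <- rs) l *: eigenproj A l.
Proof.
rewrite -[LHS]mulmx1 -sum_eigenproj mulmx_sumr.
by apply: eq_bigr => l _; exact: mul_eigenproj.
Qed.

Lemma spectral_expr k : A ^+ k = \sum_(l <- rs) l ^+ k *: eigenproj A l.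
Proof.
elim: k => [|k IH].
  by rewrite -[LHS]sum_eigenproj; apply: eq_bigr => l _; rewrite scale1r.
rewrite exprS [LHS](_ : _ = A *m A ^+ k) // IH mulmx_sumr.
by apply: eq_bigr => l _; rewrite -scalemxAr mul_eigenproj scalerA exprSr.
Qed.

Lemma spectral_invmx p :
  (forall l, l \in rs -> p + l != 0) ->
  invmx (p%:M + A) = \sum_(l <- rs) (p + l)^-1 *: eigenproj A l.
Proof.
move=> p_neq0; set B := \sum_(l <- rs) _.
have BK : (p%:M + A) *m B = 1%:M.
  rewrite mulmx_sumr -sum_eigenproj big_seq [RHS]big_seq.
  apply: eq_bigr => l /p_neq0 pl.
  rewrite -scalemxAr mulmxDl mul_scalar_mx mul_eigenproj -scalerDl scalerA.
  by rewrite mulVf // scale1r.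
have [pA_unit _] := mulmx1_unit BK.
by rewrite -[LHS]mulmx1 -BK mulmxA mulVmx // mul1mx.
Qed.

Lemma spectral_form (f : R -> R) (v : 'cV[R]_n) :
  (v^T *m (\sum_(l <- rs) f l *: eigenproj A l) *m v) 0 0 =
  \sum_(l <- rs) f l * sqnorm (eigenproj A l *m v).
Proof.
rewrite mulmx_sumr mulmx_suml summxE; apply: eq_bigr => l _.
rewrite -scalemxAr -scalemxAl mxE sqnorm_proj ?eigenproj_sym //.
exact: eigenproj_idem.
Qed.

End FunctionalCalculus.

End SpectralResolution.

(** * Positivity of the loop Laplacian *)

Section LoopLaplacian.
Variables (R : realType) (N : nat) (e : rel 'I_N) (S : {set 'I_N}).
Hypothesis e_sym : symmetric e.
Local Notation L := (loop_laplacian R e S).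

Lemma loop_laplacian_sym : L^T = L.
Proof.
rewrite /loop_laplacian /laplacian /degmx !linearD linearN /= !tr_diag_mx.
by congr (_ - _ + _); apply/matrixP => i j; rewrite !mxE e_sym.
Qed.

(** The Dirichlet form of the graph plus the contribution of the loops.  The
    factor 2 appears because each edge is counted in both directions. *)
Lemma loop_laplacian_quad (v : 'rV[R]_N) :
  (v *m L *m v^T) 0 0 *+ 2 =
  \sum_i \sum_j (e i j)%:R * (v 0 i - v 0 j) ^+ 2
  + (\sum_(i in S) v 0 i ^+ 2) *+ 2.
Proof.
have diag_quad (d : 'rV[R]_N) :
    (v *m diag_mx d *m v^T) 0 0 = \sum_i d 0 i * v 0 i ^+ 2.
  by rewrite mul_mx_diag !mxE; apply: eq_bigr => i _; rewrite !mxE mulrAC mulrC.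
rewrite /loop_laplacian /laplacian /degmx !mulmxDr !mulmxDl mulmxN mulNmx.
rewrite [LHS](_ : _ =
    ((v *m diag_mx (\row_i #|[set j | e i j]%SET|%:R) *m v^T) 0 0
     - (v *m adjmx R e *m v^T) 0 0
     + (v *m diag_mx (loop_vec R S)^T *m v^T) 0 0) *+ 2); last by rewrite !mxE.
rewrite !diag_quad mulrnDl; congr (_ + _ *+ 2); last first.
  rewrite [RHS]big_mkcond; apply: eq_bigr => i _; rewrite !mxE.
  by case: ifP; rewrite ?mul1r ?mul0r.
set a := (X in X - _); set b := (X in _ - X).
have aE : a = \sum_i \sum_j (e i j)%:R * v 0 i ^+ 2.
  apply: eq_bigr => i _; rewrite mxE -mulr_suml -natr_sum -sum1dep_card.
  by rewrite big_mkcond.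
(* Exchanging the summation indices makes the degree term symmetric in i and
   j, so that the two forms of it complete the square. *)
have aE' : a = \sum_i \sum_j (e i j)%:R * v 0 j ^+ 2.
  rewrite aE exchange_big; apply: eq_bigr => i _; apply: eq_bigr => j _.
  by rewrite e_sym.
have bE : b = \sum_i \sum_j (e i j)%:R * (v 0 i * v 0 j).
  rewrite /b mxE exchange_big; apply: eq_bigr => i _; rewrite !mxE mulr_suml.
  by apply: eq_bigr => j _; rewrite !mxE mulrCA mulrA.
rewrite mulr2n addrACA {1}aE aE' bE -opprD -!big_split -sumrB /=.
apply: eq_bigr => i _; rewrite -!big_split -sumrB /=; apply: eq_bigr => j _.
by rewrite sqrrB mulr2n; ring.
Qed.

Lemma loop_laplacian_eigenvalue_ge0 l : eigenvalue L l -> 0 <= l.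
Proof.
move=> /eigenvalueP[v vL v_neq0].
have vv_gt0 : 0 < (v *m v^T) 0 0.
  rewrite lt0r; apply/andP; split.
    apply: contra v_neq0 => /eqP vv0; apply/eqP/row_sqr_eq0.
    by rewrite [LHS]mx11_scalar vv0 raddf0.
  by rewrite mxE sumr_ge0 // => i _; rewrite mxE -expr2 sqr_ge0.
have := loop_laplacian_quad v; rewrite vL -scalemxAl mxE => quad.
have : 0 <= l * (v *m v^T) 0 0 *+ 2.
  rewrite quad addr_ge0 ?mulrn_wge0 ?sumr_ge0 // => i _; rewrite ?sqr_ge0 //.
  by apply: sumr_ge0 => j _; rewrite mulr_ge0 ?sqr_ge0 ?ler0n.
by rewrite pmulrn_lge0 // pmulr_lge0.
Qed.

End LoopLaplacian.

(** * Sums of simple fractions *)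

Section PartialFractions.
Variable K : fieldType.
Implicit Types (rs : seq K) (c : K -> K) (a z : K).

Definition partial_fractions rs c z := \sum_(a <- rs) c a / (z - a).

Lemma partial_fractions_nil c : partial_fractions [::] c = fun=> 0.
Proof. by apply/funext => w; rewrite /partial_fractions big_nil. Qed.

Lemma partial_fractions_cons a rs c :
  partial_fractions (a :: rs) c =
  fun w => c a / (w - a) + partial_fractions rs c w.
Proof. by apply/funext => w; rewrite /partial_fractions big_cons. Qed.

Lemma partial_fractions_filter rs c z :
  partial_fractions rs c z = partial_fractions [seq a <- rs | c a != 0] c z.
Proof.
rewrite /partial_fractions big_filter (bigID (fun a => c a != 0)) /=.
by rewrite [X in _ + X]big1 ?addr0 // => a /negPn/eqP ->; rewrite mul0r.
Qed.

Lemma coprimep_prod_XsubC (p : {poly K}) rs :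
  coprimep p (\prod_(a <- rs) ('X - a%:P)) = all (fun a => ~~ root p a) rs.
Proof.
elim: rs => [|a rs IH]; first by rewrite big_nil coprimep1.
by rewrite big_cons coprimepMr coprimep_XsubC IH.
Qed.

(** Terms with c a = 0 must be dropped before reducing to a common denominator:
    otherwise numerator and denominator would share the factor 'X - a.  For the
    remaining a, the numerator at a is c a \prod_(b != a) (a - b), which does not
    vanish. *)
Lemma partial_fractions_lowest_terms rs c : uniq rs ->
  exists n d : {poly K}, [/\ d != 0, coprimep n d
    & forall z, ~~ root d z -> partial_fractions rs c z = n.[z] / d.[z]].
Proof.
move=> rs_uniq; pose ps := [seq a <- rs | c a != 0].
have ps_uniq : uniq ps by rewrite filter_uniq.
pose d : {poly K} := \prod_(a <- ps) ('X - a%:P).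
pose cof a : {poly K} := \prod_(b <- ps | b != a) ('X - b%:P).
pose n := \sum_(a <- ps) c a *: cof a.
exists n, d; split=> [||z dz].
- exact/monic_neq0/monic_prod_XsubC.
- rewrite coprimep_prod_XsubC; apply/allP => a a_ps.
  have root_cof b : root (cof b) a = (a != b).
    by rewrite /cof -big_filter root_prod_XsubC mem_filter a_ps andbT.
  rewrite rootE /n horner_sum (bigD1_seq a) //= big1 => [|b ba]; last first.
    by rewrite hornerZ (rootP _) ?mulr0 // root_cof eq_sym.
  rewrite addr0 hornerZ mulf_neq0 -?rootE ?root_cof ?eqxx //.
  by move: a_ps; rewrite mem_filter => /andP[].
- rewrite partial_fractions_filter -/ps /n horner_sum mulr_suml.
  rewrite /partial_fractions big_seq [RHS]big_seq; apply: eq_bigr => a a_ps.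
  have : d.[z] = (z - a) * (cof a).[z].
    by rewrite /d (bigD1_seq a) //= hornerM hornerXsubC.
  move: dz; rewrite rootE => dz dE; rewrite dE hornerZ.
  by move: dz; rewrite dE mulf_eq0 negb_or => /andP[? ?]; field; apply/andP.
Qed.

Lemma series_geometric a z n : z != 0 -> z != a ->
  series (fun k => a ^+ k / z ^+ k.+1) n = (1 - (a / z) ^+ n) / (z - a).
Proof.
move=> z0; rewrite -subr_eq0 => za; rewrite /series /=.
elim: n => [|n IH]; first by rewrite big_nil expr0 subrr mul0r.
rewrite big_nat_recr //= IH !expr_div_n !exprS; field.
by rewrite expf_neq0 // z0 za.
Qed.

End PartialFractions.

(** * Limits of sums of simple fractions *)

Section PartialFractionsLimits.
Variable K : numFieldType.
Implicit Types (rs : seq K) (c : K -> K) (a z : K).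

(** Continuity also at those points a of the list where c a = 0: the
    corresponding term is identically zero. *)
Lemma cvg_partial_fractions (F : set_system K) {FF : Filter F} rs c z :
  F --> z ->
  (forall a, a \in rs -> a = z -> c a = 0) ->
  partial_fractions rs c w @[w --> F]
    --> partial_fractions rs c z.
Proof.
move=> Fz; elim: rs => [|a rs IH] c0.
  by rewrite partial_fractions_nil; exact: (@cvg_cst K).
rewrite partial_fractions_cons.
apply: (@cvgD _ K); last first.
  by apply: IH => b b_rs; apply: c0; rewrite inE b_rs orbT.
have [az|az] := eqVneq a z.
  rewrite (c0 a (mem_head _ _) az) mul0r (_ : (fun w => _) = fun=> 0).
    exact: (@cvg_cst K).
  by apply/funext => w; rewrite mul0r.
apply: cvgM; first exact: (@cvg_cst K).
apply: cvgV; first by rewrite subr_eq0 eq_sym.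
by apply: (@cvgB _ K); [exact: Fz|exact: (@cvg_cst K)].
Qed.

(** The term at a tends to infinity while the sum g of the others is continuous
    at a, hence bounded near a by |g a| + 1. *)
Lemma partial_fractions_large rs c a (A : K) :
  uniq rs -> a \in rs -> c a != 0 -> A \is Num.real ->
  \forall w \near a^', A <= `|partial_fractions rs c w|.
Proof.
move=> rs_uniq a_rs ca A_real.
pose g (w : K) : K := partial_fractions [seq b <- rs | b != a] c w.
have split_a w : partial_fractions rs c w = c a / (w - a) + g w.
  by rewrite /g /partial_fractions big_filter (bigD1_seq a).
have g_cvg : g w @[w --> a] --> g a.
  apply: (@cvg_partial_fractions (nbhs a) (nbhs_filter a)) => // b.
  by rewrite mem_filter => /andP[ba _] /eqP; rewrite (negPf ba).
(* As soon as |w - a| < |c a| / M the term at a exceeds M in modulus, which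
   leaves at least |A| after subtracting the bound on g. *)
pose M := `|A| + (`|g a| + 1).
have M_gt0 : 0 < M by rewrite ltr_wpDl // ltr_wpDl.
have d_gt0 : 0 < `|c a| / M by rewrite divr_gt0 ?normr_gt0.
have g_near : \forall w \near a, `|g w| <= `|g a| + 1.
  apply: (@cvgr_norm_le _ K _ (nbhs a) (nbhs_filter a) _ _ g_cvg).
  by rewrite ltrDl.
have w_near : \forall w \near a, `|w - a| < `|c a| / M.
  near=> w; rewrite distrC; near: w.
  exact: (@cvgr_dist_lt _ K _ (nbhs a) (nbhs_filter a) _ _ cvg_id).
near=> w.
have wa : 0 < `|w - a|.
  rewrite normr_gt0 subr_eq0; near: w; exact: nbhs_dnbhs_neq.
have gw : `|g w| <= `|g a| + 1 by near: w; exact: nbhs_dnbhs.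
have wd : `|w - a| < `|c a| / M by near: w; exact: nbhs_dnbhs.
rewrite split_a (le_trans (real_ler_norm _)) //.
rewrite (le_trans _ (lerB_normD _ _)) // lerBrDr.
apply: le_trans (_ : M <= _); first by rewrite lerD2l.
by rewrite normrM normfV ler_pdivlMr // mulrC -ler_pdivlMr // ltW.
Unshelve. all: by end_near.
Qed.

Lemma cvg_series_geometric a z :
  z != 0 -> z != a -> (fun n => (a / z) ^+ n) @ \oo --> (0 : K) ->
  series (fun k => a ^+ k / z ^+ k.+1) @ \oo --> (z - a)^-1.
Proof.
move=> z0 za az0.
rewrite (_ : series _ = fun n => (1 - (a / z) ^+ n) / (z - a)); last first.
  by apply/funext => n; rewrite series_geometric.
rewrite -[X in _ --> X]mul1r -[1 in X in _ --> X]subr0.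
by apply: cvgM; [apply: (@cvgB _ K) => //|]; exact: (@cvg_cst K).
Qed.

(** Stated with the convergence of (a / z)^n as a hypothesis, because over a
    general numeric field |a| < |z| does not imply it: the field may fail to be
    archimedean. *)
Lemma partial_fractions_laurent rs c z :
  z != 0 -> (forall a, a \in rs ->
    z != a /\ (fun n => (a / z) ^+ n) @ \oo --> (0 : K)) ->
  series (fun k => (\sum_(a <- rs) c a * a ^+ k) / z ^+ k.+1) @ \oo
    --> partial_fractions rs c z.
Proof.
move=> z0; elim: rs => [|a rs IH] small.
  rewrite partial_fractions_nil (_ : series _ = fun=> 0).
    exact: (@cvg_cst K).
  by apply/funext => n; rewrite /series /= big1 // => k _; rewrite big_nil mul0r.
have rs_small b : b \in rs ->
    z != b /\ (fun n => (b / z) ^+ n) @ \oo --> (0 : K).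
  by move=> b_rs; apply: small; rewrite inE b_rs orbT.
rewrite partial_fractions_cons (_ : series _ = fun n =>
    c a * series (fun k => a ^+ k / z ^+ k.+1) n
    + series (fun k => (\sum_(b <- rs) c b * b ^+ k) / z ^+ k.+1) n).
  apply: (@cvgD _ K); last exact: IH.
  apply: cvgM; first exact: (@cvg_cst K).
  by have [za az0] := small a (mem_head _ _); exact: cvg_series_geometric.
apply/funext => n; rewrite /series /= mulr_sumr -big_split /=.
by apply: eq_bigr => k _; rewrite big_cons mulrDl mulrA.
Qed.

End PartialFractionsLimits.

(** * Poles and Laurent expansion over the complex numbers *)

Section ComplexNumbers.
Variable R : realType.
Implicit Types (rs : seq R[i]) (c : R[i] -> R[i]) (a z q : R[i]).

(** The modulus takes its values in R[i]; this lets it be handled as a real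
    number. *)
Lemma normc_Re z : (complex.Re `|z|)%:C = `|z|.
Proof. by rewrite RRe_real // normr_real. Qed.

Lemma Re_normc_ge0 z : 0 <= complex.Re `|z|.
Proof. by rewrite -ler0c normc_Re. Qed.

Lemma normc_le_sum rs a :
  a \in rs -> `|a| <= (\sum_(b <- rs) complex.Re `|b|)%:C.
Proof.
elim: rs => // b rs IH; rewrite inE big_cons rmorphD /= normc_Re.
move=> /predU1P[->|/IH a_rs]; last by rewrite ler_wpDl.
rewrite lerDl ler0c sumr_ge0 // => d _; exact: Re_normc_ge0.
Qed.

(** Reduces to the powers of the real number |q|; positive elements of R[i] are
    real, so the tolerance eps can be taken in R. *)
Lemma cvg_expr_complex q :
  `|q| < 1 -> (fun n => q ^+ n : R[i]^o) @ \oo --> (0 : R[i]^o).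
Proof.
move=> q1; apply/(@cvgrPdist_lt _ R[i]^o) => eps eps_gt0.
have epsE : (complex.Re eps)%:C = eps by rewrite RRe_real // gtr0_real.
have r1 : `|complex.Re `|q| | < 1.
  by rewrite ger0_norm ?Re_normc_ge0 // -ltcR normc_Re.
have /cvgrPdist_lt/(_ (complex.Re eps)) := cvg_expr r1.
rewrite -ltcR epsE => /(_ eps_gt0); apply: filterS => n.
rewrite !sub0r !normrN !normrX [`|complex.Re _|]ger0_norm ?Re_normc_ge0 //.
by rewrite -ltcR epsE rmorphXn /= normc_Re.
Qed.

(** A function continuous at z is bounded near z, and every punctured
    neighbourhood of z is nonempty. *)
Lemma pole_not_cvg (f : R[i] -> R[i]) z :
  f w @[w --> (z : R[i]^o)] --> (f z : R[i]^o) -> ~ pole f z.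
Proof.
move=> f_cvg /cvgryPge/(_ (complex.Re (`|f z| + 1) + 1)) f_large.
have f_bounded : \forall w \near (z : R[i]^o), `|f w| <= `|f z| + 1.
  by apply: (@cvgr_norm_le _ R[i]^o _ _ _ _ _ f_cvg); rewrite ltrDl.
have [w [/= fw fw']] :=
  @filter_ex _ _ (Proper_dnbhs_regular_numFieldType _) _
    (filterI f_large (nbhs_dnbhs f_bounded)).
move: fw'; rewrite lecE => /andP[_ /(le_trans fw)].
by rewrite gerDl ler10.
Qed.

Lemma partial_fractions_poleP rs c z :
  uniq rs ->
  pole (partial_fractions rs c) z <-> z \in rs /\ c z != 0.
Proof.
move=> rs_uniq; split=> [z_pole|[z_rs cz]].
  apply: contrapT => nz; apply: pole_not_cvg z_pole.
  apply: (@cvg_partial_fractions R[i] (nbhs (z : R[i]^o))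
           (nbhs_filter (z : R[i]^o))) => // a a_rs az.
  by apply/eqP/contraT => ca; case: nz; rewrite -az.
apply/cvgryPge => A.
have A_real : A%:C \is Num.real by rewrite complex_real.
have := @partial_fractions_large R[i] rs c z A%:C rs_uniq z_rs cz A_real.
by apply: filterS => w; rewrite -[`|_|]normc_Re lecR.
Qed.

(** Any bound on the moduli of all the points would do; their sum is one that
    also makes sense for the empty list. *)
Lemma partial_fractions_laurent_complex rs c :
  exists M : R, forall z : R[i], M%:C < `|z| ->
    series (fun k => (\sum_(a <- rs) c a * a ^+ k) / z ^+ k.+1 : R[i]^o) @ \oo
      --> (partial_fractions rs c z : R[i]^o).
Proof.
exists (\sum_(a <- rs) complex.Re `|a|) => z z_large.
have z0 : z != 0.
  rewrite -normr_gt0 (le_lt_trans _ z_large) // ler0c sumr_ge0 // => a _.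
  exact: Re_normc_ge0.
apply: (@partial_fractions_laurent R[i]) => // a a_rs.
have az := le_lt_trans (normc_le_sum a_rs) z_large.
split; first by apply: contraTneq az => ->; rewrite ltxx.
by apply: cvg_expr_complex; rewrite normrM normfV ltr_pdivrMr ?mul1r ?normr_gt0.
Qed.

End ComplexNumbers.

(** * The theorem *)

Unset Implicit Arguments.

Theorem theorem5p9 (R : realType) (N : nat) (e : rel 'I_N) (S : {set 'I_N})
    (e_sym : symmetric e) (e_irr : irreflexive e) :
  let L := loop_laplacian R e S in
  let s := loop_vec R S in
  let P := eigenproj L in
  let F := loop_continuation (R := R) e S in
  L = \sum_(l \in eigenvalues L) l *: P l
  /\ (* (i) *)
  [/\ forall p : R, 0 < p ->
        loop_resolvent e S p =
          \sum_(l \in eigenvalues L) sqnorm (P l *m s) / (p + l),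
      rational_function F,
      forall p : R, 0 < p -> F p%:C = (loop_resolvent e S p)%:C
    & forall z : R[i],
        pole F z <->
        exists l : R, [/\ l \in eigenvalues L, P l *m s != 0 & z = - l%:C]]
  /\ (* (ii) *)
  exists M : R, forall z : R[i], M%:C < `|z| ->
    series (fun k => (-1) ^+ k * (loop_moment R e S k)%:C / z ^+ k.+1
              : R[i]^o) @ \oo --> (F z : R[i]^o).
Proof.
move=> L s P F.
have L_sym : L^T = L by exact: loop_laplacian_sym.
have [rs [rs_uniq evE sum1]] := spectral_resolution L_sym.
have sumE (V : nmodType) (f : R -> V) :
    \sum_(l \in eigenvalues L) f l = \sum_(l <- rs) f l.
  by rewrite evE -fsbig_seq.
have resolventE p : 0 < p ->
    loop_resolvent e S p =
    \sum_(l \in eigenvalues L) sqnorm (P l *m s) / (p + l).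
  move=> p_gt0; rewrite sumE /loop_resolvent (spectral_invmx L_sym sum1).
    rewrite spectral_form //; apply: eq_bigr => l _; exact: mulrC.
  move=> l l_rs; rewrite gt_eqF // ltr_wpDr //.
  have : eigenvalues L l by rewrite evE.
  exact: loop_laplacian_eigenvalue_ge0.
(* [loop_continuation] has denominators z + l, so its singular points are the
   opposites of the eigenvalues; the weight at a is read off at l = - a. *)
pose qs := [seq - l%:C | l <- rs].
pose c (a : R[i]) := (loop_weight e S (- complex.Re a))%:C.
have cE l : c (- l%:C) = (loop_weight e S l)%:C by rewrite /c /= opprK.
have qs_uniq : uniq qs.
  by rewrite map_inj_uniq // => l l' /oppr_inj/complexI.
have FE : F = partial_fractions qs c.
  apply/funext => z; rewrite /F /loop_continuation sumE /partial_fractions.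
  by rewrite big_map; apply: eq_bigr => l _; rewrite cE opprK.
split; first by rewrite sumE; exact: spectral_decomposition.
split; last first.
  have [M laurent] := partial_fractions_laurent_complex qs c.
  exists M => z /laurent; rewrite FE.
  rewrite (_ : (fun k => _) = fun k =>
    (-1) ^+ k * (loop_moment R e S k)%:C / z ^+ k.+1) //.
  apply/funext => k; congr (_ / _).
  rewrite /loop_moment (spectral_expr L_sym sum1) spectral_form //.
  rewrite rmorph_sum mulr_sumr big_map; apply: eq_bigr => l _.
  have powN : (- l%:C) ^+ k = (-1) ^+ k * l%:C ^+ k by exact: exprNn.
  rewrite cE powN [LHS]mulrCA; congr (_ * _).
  by rewrite -(rmorphXn (real_complex R)) -(rmorphM (real_complex R)) mulrC.
split=> // [|p p_gt0|z].
- by rewrite FE; exact: partial_fractions_lowest_terms.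
- rewrite resolventE // /F /loop_continuation !sumE rmorph_sum.
  by apply: eq_bigr => l _; rewrite rmorphM fmorphV rmorphD.
- rewrite FE (partial_fractions_poleP _ _ qs_uniq); split.
    case=> /mapP[l l_rs ->]; rewrite cE fmorph_eq0 sqnorm_eq0 => Ps; exists l.
    by split=> //; rewrite evE inE.
  case=> l [l_ev Ps ->]; split.
    by apply/mapP; exists l => //; move: l_ev; rewrite evE inE.
  by rewrite cE fmorph_eq0 sqnorm_eq0.
Qed.
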